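(* Let $q\ge 2$ be a prime power such that $3\mid q^3-1$. Then it is not the case that for every $a\in\mathbb{F}_q$ and every $b\in\mathbb{F}_q^*$ of the form $b=c^3$ with $c$ a primitive element of $\mathbb{F}_q$ there exists a $3$-primitive $1$-normal element $\xi\in\mathbb{F}_{q^3}$ over $\mathbb{F}_q$ such that $\mathrm{Tr}_{\mathbb{F}_{q^3}/\mathbb{F}_q}(\xi^{-1})=ab^{-1}$ and $\mathrm{N}_{\mathbb{F}_{q^3}/\mathbb{F}_q}(\xi)=b$.
   Context: An element $\xi\in\mathbb{F}_{q^3}^*$ is $3$-primitive (where $3\mid q^3-1$) if its multiplicative order is $(q^3-1)/3$. It is $1$-normal over $\mathbb{F}_q$ if the $\mathbb{F}_q$-linear span of $\xi,\xi^q,\xi^{q^2}$ has dimension $2$ over $\mathbb{F}_q$. A primitive element of $\mathbb{F}_q$ is a generator of $\mathbb{F}_q^*$. $\mathrm{Tr}_{\mathbb{F}_{q^3}/\mathbb{F}_q}$ and $\mathrm{N}_{\mathbb{F}_{q^3}/\mathbb{F}_q}$ are the trace and norm from $\mathbb{F}_{q^3}$ to $\mathbb{F}_q$. *)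

(* Defs.v *)
From HB Require Import structures.
From mathcomp Require Import all_boot all_order all_algebra all_fingroup.
From mathcomp Require Import all_solvable all_field.

Set Implicit Arguments.
Unset Strict Implicit.
Unset Printing Implicit Defensive.

Import GRing.Theory.
Local Open Scope ring_scope.

Definition primitive_element (F : finFieldType) (c : F) : Prop :=
  exists2 u : {unit F}, generator [set: {unit F}] u & val u = c.

(* In the next two definitions, F has q := #|F| elements and L is meant to be
   its cubic extension.  [n.-primitive_root xi] says that xi has multiplicative
   order exactly n. *)
Definition three_primitive (F : finFieldType) (L : fieldExtType F) (xi : L) :
    bool :=
  ((#|F| ^ 3 - 1) %/ 3).-primitive_root xi.

Definition one_normal (F : finFieldType) (L : fieldExtType F) (xi : L) : bool :=
  \dim (span [:: xi; xi ^+ #|F|; xi ^+ (#|F| ^ 2)]) == 2%N.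

(* Main.v *)
Require Import Defs.
From HB Require Import structures.
From mathcomp Require Import all_boot all_order all_algebra all_fingroup.
From mathcomp Require Import all_solvable all_field.
From mathcomp Require Import ring.

Set Implicit Arguments.
Unset Strict Implicit.
Unset Printing Implicit Defensive.

Import GRing.Theory.
Local Open Scope ring_scope.

(** The pair to look at is a = 0 with an arbitrary admissible b: no 1-normal
    element xi has Tr(xi^-1) = 0.

    Write x, y = x^q, z = x^(q^2) for the conjugates of xi = x and e1, e2, e3
    for their elementary symmetric functions.  Since Tr(x^-1) = e2 / e3, the
    trace condition says e2 = 0.  A linear dependency of the conjugates over F_q
    makes the circulant determinant x^3 + y^3 + z^3 - 3xyz = e1 (e1^2 - 3 e2)
    vanish ([circulant_eq0]), so that e1^3 = 0 as well.  Then x, y, z are all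
    roots of T^3 - e3 ([eq_cubes_of_circulant_eq0]), and y / x is a cube root of
    unity.  From 3 | q^3 - 1 follows 3 | q - 1, so y / x lies in F_q, and the
    conjugates span only a line ([one_normal_trace_inv_neq0]), which contradicts
    1-normality.  An admissible b exists because the multiplicative group of a
    finite field is cyclic. *)

Lemma big_cycle_expg (gT : finGroupType) (R : Type) (idx : R)
    (op : Monoid.com_law idx) (g : gT) (f : gT -> R) :
  \big[op/idx]_(h in <[g]>%g) f h = \big[op/idx]_(i < #[g]%g) f (g ^+ i)%g.
Proof.
(* The powers of g arise by iterating left multiplication by g, the form in
   which [cycle_traject] lists <[g]>. *)
have perm_cycle : perm_eq (enum <[g]>%g) [seq (g ^+ i)%g | i <- iota 0 #[g]%g].
  have -> : [seq (g ^+ i)%g | i <- iota 0 #[g]%g] = traject (mulg g) 1%g #[g]%g.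
    apply: (@eq_from_nth _ 1%g) => [|i]; rewrite size_map size_iota.
      by rewrite size_traject.
    move=> lt_i; rewrite (nth_map 0%N) ?size_iota // nth_iota // nth_traject //.
    by elim: i {lt_i} => //= i <-; rewrite expgS.
  have eq_mem : enum <[g]>%g =i traject (mulg g) 1%g #[g]%g.
    by move=> h; rewrite mem_enum cycle_traject.
  apply: uniq_perm => //; first exact: enum_uniq.
  by rewrite (uniq_size_uniq (enum_uniq _) eq_mem) size_traject -cardE.
rewrite -big_enum /= (perm_big _ perm_cycle) /= big_map.
by rewrite -(big_mkord xpredT (fun i => f (g ^+ i)%g)) /index_iota subn0.
Qed.

(** The Galois group is generated by the Frobenius map; its order is recorded
    because the trace formula sums over exactly that many powers. *)
Lemma finField_frobenius (F : finFieldType) (L : splittingFieldType F) :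
  {alpha : gal_of {:L}
     | 'Gal({:L} / 1)%g = <[alpha]>%g /\ #[alpha]%g = \dim {:L}
     & forall x, alpha x = x ^+ #|F|}.
Proof.
have [alpha /eqP gal_alpha frob] :=
  @finField_galois_generator F L 1%AS {:L}%AS (subvf _).
exists alpha; last by move=> x; rewrite frob ?memvf // dimv1.
split=> //; rewrite orderE -gal_alpha -(galois_dim (finField_galois (subvf _))).
by rewrite dimv1 divn1.
Qed.

Lemma frobenius_iter (F : finFieldType) (L : splittingFieldType F)
    (alpha : gal_of {:L}) :
    (forall x, alpha x = x ^+ #|F|) ->
  forall i x, (alpha ^+ i)%g x = x ^+ (#|F| ^ i).
Proof.
move=> frob i x; elim: i => [|i IHi]; first by rewrite gal_id expr1.
by rewrite expgSr galM ?memvf // frob IHi -exprM expnSr.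
Qed.

(** The Galois group consists of the distinct powers of the Frobenius map, so
    the trace is the sum of the iterated #|F|-th powers. *)
Lemma galTrace_finField (F : finFieldType) (L : splittingFieldType F) (x : L) :
  galTrace 1 {:L} x = \sum_(i < \dim {:L}) x ^+ (#|F| ^ i).
Proof.
have [alpha [gal_alpha dim_alpha] frob] := finField_frobenius L.
rewrite /galTrace gal_alpha big_cycle_expg dim_alpha.
by apply: eq_bigr => i _; rewrite frobenius_iter.
Qed.

(** An element fixed by Frobenius is fixed by the whole Galois group, which
    Frobenius generates, hence lies in the base field. *)
Lemma finField_mem1v (F : finFieldType) (L : splittingFieldType F) (x : L) :
  x ^+ #|F| = x -> x \in 1%VS.
Proof.
have [alpha [gal_alpha _] frob] := finField_frobenius L.
move=> fix_x; have <- := galois_fixedField (finField_galois (sub1v {:L}%AS)).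
apply/fixedFieldP=> [|beta]; first exact: memvf.
rewrite gal_alpha => /cycleP[i ->]; rewrite frobenius_iter //.
by elim: i => [|i IHi]; rewrite ?expr1 // expnSr exprM IHi.
Qed.

Lemma expf_card_dim (F : finFieldType) (L : splittingFieldType F) (x : L) :
  x ^+ (#|F| ^ \dim {:L}) = x.
Proof.
have [alpha [_ dim_alpha] frob] := finField_frobenius L.
by rewrite -(frobenius_iter frob) -dim_alpha expg_order gal_id.
Qed.

(** A vector in the kernel of the circulant matrix of (x, y, z) is annihilated
    by its determinant d: each identity below is one row of the adjugate matrix
    applied to the three relations. *)
Lemma circulant_kernel (R : comPzRingType) (x y z a b c : R) :
    a * x + b * y + c * z = 0 -> a * y + b * z + c * x = 0 ->
    a * z + b * x + c * y = 0 ->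
  let d := x ^+ 3 + y ^+ 3 + z ^+ 3 - 3 * (x * y * z) in
  [/\ a * d = 0, b * d = 0 & c * d = 0].
Proof.
move=> e1 e2 e3.
have combo u v w s :
    s = u * (a * x + b * y + c * z) + v * (a * y + b * z + c * x)
        + w * (a * z + b * x + c * y) -> s = 0.
  by rewrite e1 e2 e3 !mulr0 !addr0.
split.
- apply: (combo (x ^+ 2 - y * z) (y ^+ 2 - z * x) (z ^+ 2 - x * y)); ring.
- apply: (combo (y ^+ 2 - z * x) (z ^+ 2 - x * y) (x ^+ 2 - y * z)); ring.
- apply: (combo (z ^+ 2 - x * y) (x ^+ 2 - y * z) (y ^+ 2 - z * x)); ring.
Qed.

(** Frobenius is F-linear and permutes x, y, z cyclically, so an F-linear
    relation among them yields its two cyclic shifts: its coefficients are in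
    the kernel of the circulant matrix.  A nonzero determinant would thus make
    the three conjugates independent, and their span of dimension 3. *)
Lemma circulant_eq0 (F : finFieldType) (L : splittingFieldType F) (x : L) :
  \dim {:L} = 3%N -> one_normal x ->
  let y := x ^+ #|F| in let z := x ^+ (#|F| ^ 2) in
  x ^+ 3 + y ^+ 3 + z ^+ 3 - 3 * (x * y * z) = 0.
Proof.
move=> dimL normx y z; apply: contraTeq normx => det_neq0.
have free_xyz : free [tuple x; y; z].
  apply/freeP=> k; rewrite !big_ord_recl big_ord0 addr0 /= addrA.
  set a := k ord0; set b := k (lift _ _); set c := k (lift _ _) => rel.
  have [alpha _ frob] := finField_frobenius L.
  have [ax ay az] : [/\ alpha x = y, alpha y = z & alpha z = x].
    split; rewrite frob // -exprM //.
    by rewrite -expnSr -dimL expf_card_dim.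
  have alphaD u v w : alpha (a *: u + b *: v + c *: w)
      = a *: alpha u + b *: alpha v + c *: alpha w.
    by rewrite 2!linearD 3!linearZ.
  have rel1 : a *: y + b *: z + c *: x = 0.
    by have /esym := alphaD x y z; rewrite ax ay az rel linear0.
  have rel2 : a *: z + b *: x + c *: y = 0.
    by have /esym := alphaD y z x; rewrite ax ay az rel1 linear0.
  have scal0 t :
      t%:A * (x ^+ 3 + y ^+ 3 + z ^+ 3 - 3 * (x * y * z)) = 0 -> t = 0.
    move/eqP; rewrite mulf_eq0 (negPf det_neq0) orbF scaler_eq0 oner_eq0 orbF.
    by move/eqP.
  rewrite -!(mulr_algl _ x, mulr_algl _ y, mulr_algl _ z) in rel rel1 rel2.
  have [/scal0 a0 /scal0 b0 /scal0 c0] := circulant_kernel rel rel1 rel2.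
  case=> [[|[|[|//]]] lt_i].
  - by rewrite -[RHS]a0; congr k; apply: val_inj.
  - by rewrite -[RHS]b0; congr k; apply: val_inj.
  - by rewrite -[RHS]c0; congr k; apply: val_inj.
by move: free_xyz; rewrite /free /one_normal -/y -/z => /eqP->.
Qed.

(** In terms of the elementary symmetric functions, the circulant determinant
    is e1^3 - 3 e1 e2.  With e2 = 0 it forces e1 = 0, and then x and y are roots
    of T^3 - e3. *)
Lemma eq_cubes_of_circulant_eq0 (R : idomainType) (x y z : R) :
    x ^+ 3 + y ^+ 3 + z ^+ 3 - 3 * (x * y * z) = 0 ->
    x * y + y * z + z * x = 0 ->
  x ^+ 3 = y ^+ 3.
Proof.
move=> det0 e2.
have e1 : x + y + z = 0.
  suff /eqP : (x + y + z) ^+ 3 = 0 by rewrite expf_eq0 => /eqP.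
  transitivity (x ^+ 3 + y ^+ 3 + z ^+ 3 - 3 * (x * y * z)
      + 3 * (x + y + z) * (x * y + y * z + z * x)); first ring.
  by rewrite det0 e2 mulr0 addr0.
apply/eqP; rewrite -subr_eq0; apply/eqP.
transitivity
  ((x - y) * ((x + y) * (x + y + z) - (x * y + y * z + z * x))); first ring.
by rewrite e1 e2 mulr0 subr0 mulr0.
Qed.

Lemma dim_span3_le1 (K : fieldType) (V : vectType K) (x y z : V) :
  y \in <[x]>%VS -> z \in <[x]>%VS -> (\dim (span [:: x; y; z]) <= 1)%N.
Proof.
move=> xy xz; apply: (@leq_trans (\dim <[x]>)); last first.
  by rewrite dim_vline; case: eqP.
apply/dimvS/span_subvP=> t; rewrite !inE.
by case/or3P=> /eqP-> //; apply: memv_line.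
Qed.

Lemma one_normal_neq0 (F : finFieldType) (L : splittingFieldType F) (x : L) :
  one_normal x -> x != 0.
Proof.
apply: contraTneq => ->; rewrite /one_normal !expr0n expn_eq0.
rewrite (gtn_eqF (ltnW (finNzRing_gt1 F))) /=.
have := dim_span3_le1 (mem0v <[0 : L]>) (mem0v <[0 : L]>).
by case: (\dim _) => [|[]].
Qed.

(** If the trace vanished, then e2 = e3 Tr(x^-1) = 0, so x and its conjugate y
    would have the same cube.  Their ratio, a cube root of unity, lies in F
    because 3 divides #|F| - 1; so all the conjugates would be on one F-line. *)
Lemma one_normal_trace_inv_neq0 (F : finFieldType) (L : splittingFieldType F)
    (x : L) :
    (3 %| #|F|.-1)%N -> \dim {:L} = 3%N -> one_normal x ->
  galTrace 1 {:L} x^-1 != 0.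
Proof.
move=> /dvdnP[k q3] dimL normx; apply/eqP=> tr0.
set y := x ^+ #|F|; set z := x ^+ (#|F| ^ 2).
have x0 := one_normal_neq0 normx.
have e2 : x * y + y * z + z * x = 0.
  move: tr0; rewrite galTrace_finField dimL !big_ord_recl big_ord0 /=.
  rewrite /bump /= !addn0 !add1n expn1 expr1 !exprVn -/y -/z.
  move/(congr1 ( *%R (x * y * z))); rewrite mulr0 => <-.
  by field; rewrite x0 !expf_neq0.
have x3y3 := eq_cubes_of_circulant_eq0 (circulant_eq0 dimL normx) e2.
have rF : y / x \in 1%VS.
  apply: finField_mem1v.
  have -> : #|F| = (3 * k).+1.
    by rewrite mulnC -q3 prednK // ltnW // finNzRing_gt1.
  by rewrite exprS exprM expr_div_n -x3y3 divff ?expf_neq0 // expr1n mulr1.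
have [r yr] : exists r : F, y = r *: x.
  case/vlineP: rF => r /(congr1 ( *%R^~ x)); rewrite mulfVK // mulr_algl.
  by exists r.
have : (\dim (span [:: x; y; z]) <= 1)%N.
  have zE : z = r *: y.
    by rewrite {1}/z expnSr exprM expn1 -/y {1}yr exprZn expf_card.
  by apply: dim_span3_le1; rewrite ?zE ?yr ?memvZ ?memv_line.
by rewrite leqNgt (eqP normx).
Qed.

Theorem lemma4p11 (q : nat) (F : finFieldType) (hF : #|F| = q)
    (L : splittingFieldType F) (hL : \dim {:L} = 3%N)
    (hq : (3 %| q ^ 3 - 1)%N) :
  ~ (forall (a b : F),
       b != 0 ->
       (exists2 c : F, primitive_element c & b = c ^+ 3) ->
       exists xi : L,
         [/\ three_primitive xi,
             one_normal xi,
             galTrace 1 {:L} xi^-1 = (a * b^-1)%:A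
           & galNorm 1 {:L} xi = b%:A]).
Proof.
move=> sol; rewrite -hF in hq.
have q_gt0 : (0 < #|F|)%N := ltnW (finNzRing_gt1 F).
have q3 : (3 %| #|F|.-1)%N.
  rewrite -subn1 -eqn_mod_dvd // -(@fermat_little #|F| 3) //.
  by rewrite eqn_mod_dvd // expn_gt0 q_gt0.
have [u gen_u] : exists u : {unit F}, generator [set: {unit F}] u.
  have /cyclicP[u def_u] := field_unit_group_cyclic [set: {unit F}].
  by exists u; apply/eqP.
have u0 : val u != 0 by rewrite -unitfE (valP u).
have [|xi [_ normal_xi tr_xi _]] := sol 0 (val u ^+ 3) (expf_neq0 _ u0).
  by exists (val u) => //; exists u.
have /eqP[] := one_normal_trace_inv_neq0 q3 hL normal_xi.
by rewrite tr_xi mul0r scale0r.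
Qed.
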